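(* Let $K$ be a field of characteristic $0$ and let $n \geq 1$ be an integer. Let $V = K^n$ be the natural representation of the symmetric group $S_n$, and let $S_n$ act diagonally on $V^2 = V \times V$. Let \[ I = \{ (j,k) \in \mathbb{N}^2 \mid 0 \leq j \leq n,\ 0 \leq k \leq \lfloor \tfrac{n}{j+1} \rfloor,\ (j,k) \neq (0,0) \}, \] and for $(j,k) \in I$ let $f_{j,k} = \sum_{i=1}^n x_i^j y_i^k$. Then $S := \{ f_{j,k} \mid (j,k) \in I \}$ is a separating subset of the ring of bisymmetric polynomials $K[V^2]^{S_n}$.
   Context: Here $\mathbb{N}$ includes $0$. The coordinate ring is $K[V^2] = K[x_1,\ldots,x_n,y_1,\ldots,y_n]$, where $x_1,\ldots,x_n$ are the coordinates on the first copy of $V$ and $y_1,\ldots,y_n$ those on the second copy. The group $S_n$ acts on $V^2 = K^n \times K^n$ by permuting the $n$ coordinates of both copies simultaneously, and $K[V^2]^{S_n}$ is the ring of polynomials invariant under the induced simultaneous permutation of the $x_i$ and the $y_i$. A subset $T \subseteq K[V^2]^{S_n}$ is called separating if for all points $p,q \in V^2$: whenever there is an invariant $f \in K[V^2]^{S_n}$ with $f(p) \neq f(q)$, there is an element $g \in T$ with $g(p) \neq g(q)$. (Since $S_n$ is finite, this is equivalent to: if $g(p)=g(q)$ for all $g \in T$, then $p$ and $q$ lie in the same $S_n$-orbit.) *)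

(* Defs.v *)
From HB Require Import structures.
From mathcomp Require Import all_boot all_order all_fingroup all_algebra.
From mathcomp Require Import mpoly.

Set Implicit Arguments.
Unset Strict Implicit.
Unset Printing Implicit Defensive.

Import GRing.Theory.
Local Open Scope ring_scope.

(* K[V^2] is {mpoly K[n + n]}: the first n variables are the coordinates x_i
   on the first copy of V = K^n, the last n are the coordinates y_i on the
   second copy. *)

Definition xvar (K : fieldType) (n : nat) (i : 'I_n) : {mpoly K[n + n]} :=
  'X_(lshift n i).

Definition yvar (K : fieldType) (n : nat) (i : 'I_n) : {mpoly K[n + n]} :=
  'X_(rshift n i).

Definition diag_fun (n : nat) (s : 'S_n) (i : 'I_(n + n)) : 'I_(n + n) :=
  match split i with
  | inl a => lshift n (s a)
  | inr b => rshift n (s b)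
  end.

Lemma diag_fun_inj (n : nat) (s : 'S_n) : injective (diag_fun s).
Proof.
move=> i j; rewrite /diag_fun -[i]splitK -[j]splitK !unsplitK.
case: (split i) => a; case: (split j) => b /= /eqP;
  rewrite ?eq_lshift ?eq_rshift ?eq_lrshift ?eq_rlshift //.
- by move=> /eqP /perm_inj ->.
- by move=> /eqP /perm_inj ->.
Qed.

Definition diag_perm (n : nat) (s : 'S_n) : 'S_(n + n) :=
  perm (@diag_fun_inj n s).

Definition bisymmetric (K : fieldType) (n : nat) (f : {mpoly K[n + n]}) : Prop :=
  forall s : 'S_n, msym (diag_perm s) f = f.

Definition eval2 (K : fieldType) (n : nat) (f : {mpoly K[n + n]})
    (p : 'rV[K]_n * 'rV[K]_n) : K :=
  f.@[row_mx p.1 p.2 0].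

(* The action on polynomials by simultaneous permutation of the variables is
   the one induced by the diagonal action of S_n on V^2. *)
Lemma eval2_msym (K : fieldType) (n : nat) (s : 'S_n) (f : {mpoly K[n + n]})
    (p : 'rV[K]_n * 'rV[K]_n) :
  eval2 (msym (diag_perm s) f) p = eval2 f (col_perm s p.1, col_perm s p.2).
Proof.
rewrite /eval2; elim/mpolyind: f => [|c m f _ _ IHf].
  by rewrite msym0 !meval0.
rewrite msymD msymZ !mevalD !mevalZ IHf msymX !mevalX.
congr (_ * _ + _).
rewrite (reindex_inj (@perm_inj _ (diag_perm s))) /=; apply: eq_bigr => i _.
rewrite mnmE permK permE /diag_fun -[i]splitK unsplitK.
by case: (split i) => a /=; rewrite ?row_mxEl ?row_mxEr mxE.
Qed.

Definition separating (K : fieldType) (n : nat)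
    (T : {mpoly K[n + n]} -> Prop) : Prop :=
  (forall g, T g -> bisymmetric g) /\
  forall p q : 'rV[K]_n * 'rV[K]_n,
    (exists f, bisymmetric f /\ eval2 f p <> eval2 f q) ->
    exists g, T g /\ eval2 g p <> eval2 g q.

Definition index_set (n j k : nat) : Prop :=
  [/\ (0 <= j <= n)%N, (0 <= k <= n %/ j.+1)%N & (j, k) <> (0%N, 0%N)].

Definition fjk (K : fieldType) (n j k : nat) : {mpoly K[n + n]} :=
  \sum_(i < n) xvar K i ^+ j * yvar K i ^+ k.

Definition S_set (K : fieldType) (n : nat) (f : {mpoly K[n + n]}) : Prop :=
  exists j k : nat, index_set n j k /\ f = fjk K n j k.

(* Main.v *)
Require Import Defs.
From mathcomp Require Import all_boot all_order all_fingroup all_algebra.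
From mathcomp Require Import mpoly.
From mathcomp Require Import ring zify.

Set Implicit Arguments.
Unset Strict Implicit.
Unset Printing Implicit Defensive.

Import GRing.Theory.
Local Open Scope ring_scope.

(** Write D_k(a) for the difference between p and q of the sums of y_i ^ k
    over the indices i with x_i = a.  Points on which the f_{j,k} agree satisfy
    sum_a a^j D_k(a) = 0 for all j <= n and k with k (j + 1) <= n, and the aim
    is D_k(a) = 0 for all k and a.

    In characteristic 0, m numbers are determined as a multiset by their power
    sums of degree at most m, by Newton's identities ([perm_eq_power_sums]).
    Applied to the f_{j,0} this shows that p and q have the same multiset of
    x-coordinates, so the fibers of p and q over each value a have a common
    size n_a.  Then argue by strong induction on k.  If n_a < k, the vanishing
    of D_i(a) for i < k already forces the two fibers over a to be equal
    multisets, so D_k(a) = 0.  There remain the values a with n_a >= k; as the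
    n_a add up to n, there are at most n / k of them ([size_large_fibers]), and
    the equations with j < n / k form a Vandermonde system with at least as
    many rows as unknowns, so D_k vanishes there too ([vandermonde_zero]).  The
    bound k <= n / (j + 1) of the index set is exactly the one that makes this
    count work.

    Thus all fibers agree, p and q are equal as multisets of n pairs
    ([perm_eq_bivariate_power_sums]), i.e. they lie in one orbit, and no
    invariant can tell them apart. *)

Section PowerSums.

Variable K : fieldType.
Implicit Types (u v : seq K) (s t : seq (K * K)).

Lemma drop_poly_recl (p : {poly K}) l :
  drop_poly l p = (p`_l)%:P + drop_poly l.+1 p * 'X.
Proof.
apply/polyP=> i; rewrite coefD coefMX coefC !coef_drop_poly.
by case: i => [|i] /=; rewrite ?addr0 // add0r addnS addSn.
Qed.

Lemma drop_poly_mulXsubC (p : {poly K}) a l :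
  drop_poly l.+1 (('X - a%:P) * p) =
    ('X - a%:P) * drop_poly l.+1 p + (p`_l)%:P.
Proof.
apply/polyP=> i.
rewrite coefD !mulrBl !coefB !coefXM !coefCM coefC !coef_drop_poly.
rewrite coefB coefXM coefCM.
by case: i => [|i]; rewrite /= ?addnS ?add0n ?addSn /=; ring.
Qed.

(** Newton's identities for p = prod_x (X - x), whose coefficients are the
    elementary symmetric functions up to sign: evaluating [drop_poly l p],
    which is sum_b p_(l+b) X^b, turns the left side into sum_b p_(l+b) times
    the b-th power sum.  Indexing by the low coefficient l rather than by the
    degree of the symmetric function avoids truncated sums, and lets the case
    l = 0 say that the x are roots of p.  The induction adds one root at a
    time, through [drop_poly_mulXsubC]. *)
Lemma newton_drop_poly u l :
  \sum_(x <- u) (drop_poly l (\prod_(x <- u) ('X - x%:P))).[x] =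
    (\prod_(x <- u) ('X - x%:P))`_l *+ l.
Proof.
elim: u l => [|a u IHu] [|l].
1,2: by rewrite !big_nil ?mulr0n ?coef1 ?mul0rn.
  rewrite big1_seq // => x /andP[_ ux]; rewrite drop_poly0l.
  by apply/eqP; rewrite -[_ == 0]/(root _ _) root_prod_XsubC.
set p := \prod_(x <- u) ('X - x%:P) in IHu *.
have -> : \prod_(x <- a :: u) ('X - x%:P) = ('X - a%:P) * p by rewrite big_cons.
rewrite drop_poly_mulXsubC big_cons !hornerE subrr mul0r add0r.
have -> : \sum_(x <- u) (('X - a%:P) * drop_poly l.+1 p + (p`_l)%:P).[x]
   = \sum_(x <- u) ((drop_poly l p).[x] - a * (drop_poly l.+1 p).[x]).
  by apply: eq_bigr => x _; rewrite (drop_poly_recl p l) !hornerE; ring.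
rewrite sumrB -mulr_sumr !IHu mulrBl coefB coefXM coefCM /= mulrnBl mulrS.
by ring.
Qed.

(** The term b = 0 of [newton_drop_poly] contributes [size u] times the
    coefficient of X^l; moving it across solves for that coefficient. *)
Lemma newton_coef u l (p := \prod_(x <- u) ('X - x%:P)) :
    (l <= size u)%N ->
  p`_l *+ (size u - l) = - \sum_(x <- u) (drop_poly l.+1 p * 'X).[x].
Proof.
move=> le_lu; have := newton_drop_poly u l; rewrite -/p.
under eq_bigr => x _ do rewrite (drop_poly_recl p l) hornerD hornerC.
rewrite big_split /= big_const_seq count_predT iter_addr_0 mulrnBr // => <-.
by rewrite opprD addrA subrr add0r.
Qed.

Lemma eq_sum_horner u v (p : {poly K}) m :
    (forall k, (k <= m)%N -> \sum_(x <- u) x ^+ k = \sum_(x <- v) x ^+ k) ->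
    (size p <= m.+1)%N ->
  \sum_(x <- u) p.[x] = \sum_(x <- v) p.[x].
Proof.
move=> eq_uv le_p_m.
have sum_horner w : \sum_(x <- w) p.[x] =
    \sum_(k < m.+1) p`_k * \sum_(x <- w) x ^+ k.
  under eq_bigr => x _ do rewrite (horner_coef_wide x le_p_m).
  by rewrite exchange_big; apply: eq_bigr => k _; rewrite mulr_sumr.
by rewrite !sum_horner; apply: eq_bigr => k _; rewrite eq_uv // -ltnS.
Qed.

(** With m = [size u], [newton_coef] expresses (m - l) times the coefficient
    of X^l in the monic polynomial with roots u through its higher coefficients
    and power sums of degree at most m.  In characteristic 0 this determines
    the coefficients from the top down, hence the multiset of roots. *)
Lemma perm_eq_power_sums (charK0 : [pchar K] =i pred0) u v :
    size u = size v ->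
    (forall k, (k <= size u)%N ->
       \sum_(x <- u) x ^+ k = \sum_(x <- v) x ^+ k) ->
  perm_eq u v.
Proof.
move=> eq_sz eq_uv; apply: prod_XsubC_eq.
have := @newton_coef v; have := @newton_coef u; rewrite -eq_sz /=.
set p := \prod_(x <- u) _; set q := \prod_(x <- v) _.
set m := size u in eq_sz eq_uv *.
move=> newt_p newt_q.
have szp : size p = m.+1 by rewrite size_prod_XsubC.
have szq : size q = m.+1 by rewrite size_prod_XsubC -eq_sz.
suff eq_drop k : (k <= m)%N -> drop_poly (m - k) p = drop_poly (m - k) q.
  by have := eq_drop m (leqnn m); rewrite subnn !drop_poly0l.
elim: k => [|k IHk] lt_km.
  (* Only the leading coefficient, 1, remains. *)
  have lead (r : {poly K}) :
      size r = m.+1 -> r \is monic -> drop_poly (m - 0) r = 1.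
    move=> szr /monicP; rewrite lead_coefE szr /= => lr.
    rewrite subn0 drop_poly_recl lr drop_poly_eq0 ?szr //.
    by rewrite mul0r addr0.
  by rewrite !lead // monic_prod_XsubC.
set l := (m - k.+1)%N; have lt_lm : (l < m)%N by rewrite /l; lia.
have Sl : l.+1 = (m - k)%N by rewrite /l; lia.
have := IHk (ltnW lt_km); rewrite -Sl => eq_dropS.
have eq_l : p`_l = q`_l.
  have: p`_l *+ (m - l) = q`_l *+ (m - l).
    rewrite newt_p ?newt_q ?(ltnW lt_lm) // -eq_dropS; congr (- _).
    apply: eq_sum_horner eq_uv _.
    apply: leq_trans (size_polyMleq _ _) _.
    by rewrite size_polyX size_drop_poly szp; lia.
  move/eqP; rewrite -subr_eq0 -mulrnBl -mulr_natr mulf_eq0 subr_eq0.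
  by case/orP => [/eqP //|]; rewrite (pcharf0P _).1 //; lia.
by rewrite (drop_poly_recl p) (drop_poly_recl q) eq_l eq_dropS.
Qed.

(** The hypothesis says that sum_a p(a) D(a) = 0 for every polynomial p of
    degree less than [size r].  The product of the X - a over the elements a
    of r other than b is such a p, and it isolates D(b). *)
Lemma vandermonde_zero (r : seq K) (D : K -> K) :
    uniq r ->
    (forall j, (j < size r)%N -> \sum_(a <- r) a ^+ j * D a = 0) ->
  {in r, forall a, D a = 0}.
Proof.
move=> uniq_r D0 b rb.
pose p := \prod_(a <- rem b r) ('X - a%:P).
have szp : size p = size r.
  by rewrite size_prod_XsubC size_rem // prednK //; case: (r) rb.
have pD0 : \sum_(a <- r) p.[a] * D a = 0.
  under eq_bigr => a _ do
    rewrite (horner_coef_wide a (leqnn _)) mulr_suml.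
  rewrite exchange_big big1 // => j _.
  under eq_bigr => a _ do rewrite -mulrA.
  by rewrite -mulr_sumr D0 ?mulr0 // -szp.
move: pD0; rewrite (big_rem b) //= big1_seq ?addr0; last first.
  move=> a /andP[_ ra]; have: root p a by rewrite root_prod_XsubC.
  by move/rootP->; rewrite mul0r.
move/eqP; rewrite mulf_eq0 -[_ == 0]/(root p b) root_prod_XsubC.
by rewrite mem_rem_uniqF // => /eqP.
Qed.

Definition fiber s (a : K) : seq K := [seq z.2 | z <- s & z.1 == a].

Lemma size_fiber s a : size (fiber s a) = count_mem a (unzip1 s).
Proof. by rewrite size_map size_filter count_map. Qed.

Lemma count_fiber s a b : count_mem b (fiber s a) = count_mem (a, b) s.
Proof.
rewrite count_map count_filter; apply: eq_count => -[x y] /=.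
by rewrite xpair_eqE andbC.
Qed.

Lemma sum_fibers s (r : seq K) (F : K -> K -> K) :
    uniq r -> {subset unzip1 s <= r} ->
  \sum_(z <- s) F z.1 z.2 = \sum_(a <- r) \sum_(y <- fiber s a) F a y.
Proof.
move=> uniq_r sub_sr.
under [RHS]eq_bigr => a _ do rewrite big_map big_filter.
rewrite (exchange_big_dep predT) //=; apply: eq_big_seq => z sz.
have rz : z.1 \in r by apply/sub_sr/map_f.
rewrite (big_rem z.1) //= eqxx big1_seq ?addr0 // => a /andP[/eqP <-].
by rewrite mem_rem_uniqF.
Qed.

(** Fibers over distinct values are disjoint, so at most [size s / k] of them
    can have k elements or more. *)
Lemma size_large_fibers s k :
  (k * size [seq a <- undup (unzip1 s) | k <= size (fiber s a)] <= size s)%N.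
Proof.
set r := [seq a <- _ | _].
have uniq_r : uniq r by rewrite filter_uniq ?undup_uniq.
rewrite -[size s](size_map fst) -/(unzip1 s) -iter_addn_0.
rewrite -[X in iter X](count_predT r) -big_const_seq.
apply: (@leq_trans (\sum_(a <- r) count_mem a (unzip1 s))%N).
  rewrite big_seq [leqRHS]big_seq; apply: leq_sum => a.
  by rewrite mem_filter -size_fiber => /andP[].
under eq_bigr => a _ do rewrite -sum1_count big_mkcond.
rewrite exchange_big /= -sum1_size; apply: leq_sum => x _.
rewrite -big_mkcond sum1_count (eq_count (a2 := pred1 x)) //.
by rewrite count_uniq_mem ?leq_b1.
Qed.

(** The heart of the argument: strong induction on k proves that the fibers of
    s and t over each value have the same k-th power sum. *)
Lemma perm_eq_bivariate_power_sums (charK0 : [pchar K] =i pred0) n s t :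
    size s = n -> size t = n ->
    (forall j k, (j <= n)%N -> (k <= n %/ j.+1)%N ->
       \sum_(z <- s) z.1 ^+ j * z.2 ^+ k = \sum_(z <- t) z.1 ^+ j * z.2 ^+ k) ->
  perm_eq s t.
Proof.
move=> szs szt eq_st.
have perm1 : perm_eq (unzip1 s) (unzip1 t).
  apply: perm_eq_power_sums => //; rewrite !size_map ?szs ?szt // => j le_jn.
  rewrite !big_map; have := eq_st j 0%N le_jn (leq0n _).
  have sum0 w : \sum_(z <- w) z.1 ^+ j * z.2 ^+ 0 = \sum_(z <- w) z.1 ^+ j :> K.
    by apply: eq_bigr => z _; rewrite mulr1.
  by rewrite !sum0.
have eq_szf a : size (fiber s a) = size (fiber t a).
  by rewrite !size_fiber; apply/seq.permP.
have eq_fib k a : \sum_(y <- fiber s a) y ^+ k = \sum_(y <- fiber t a) y ^+ k.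
  elim/ltn_ind: k a => k IHk a.
  (* Fibers with fewer than k elements agree by the induction hypothesis. *)
  have small b : (size (fiber s b) < k)%N ->
      \sum_(y <- fiber s b) y ^+ k = \sum_(y <- fiber t b) y ^+ k.
    move=> lt_bk; apply: perm_big; apply: perm_eq_power_sums => // i le_i.
    by apply: IHk; apply: leq_ltn_trans lt_bk.
  have [/small //|le_ka] := ltnP (size (fiber s a)) k.
  case: k => [|k'] in IHk small le_ka *.
    by rewrite !big_const_seq !count_predT eq_szf.
  set k := k'.+1 in IHk small le_ka *.
  pose D b := \sum_(y <- fiber s b) y ^+ k - \sum_(y <- fiber t b) y ^+ k.
  suff: D a = 0 by move/eqP; rewrite subr_eq0 => /eqP.
  pose r := [seq b <- undup (unzip1 s) | (k <= size (fiber s b))%N].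
  have sz_r : (size r <= n %/ k)%N.
    by rewrite leq_divRL // mulnC -szs size_large_fibers.
  have : a \in r.
    rewrite mem_filter le_ka mem_undup -has_pred1 has_count -size_fiber.
    exact: leq_trans le_ka.
  apply: vandermonde_zero; first by rewrite filter_uniq // undup_uniq.
  move=> j lt_jr; have lt_jk := leq_trans lt_jr sz_r.
  have le_jn : (j <= n)%N.
    by apply: ltnW; apply: leq_trans lt_jk (leq_div _ _).
  have le_kj : (k <= n %/ j.+1)%N.
    by move: lt_jk; rewrite !leq_divRL // mulnC.
  rewrite big_filter big_mkcond /=.
  (* Small fibers do not contribute, so the sum may run over all values. *)
  transitivity (\sum_(b <- undup (unzip1 s)) b ^+ j * D b).
    apply: eq_bigr => b _; case: ltnP => // /small; rewrite /D => ->.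
    by rewrite subrr mulr0.
  under eq_bigr do rewrite mulrBr !mulr_sumr.
  rewrite sumrB -!(sum_fibers (fun x y => x ^+ j * y ^+ k)) ?undup_uniq //.
  - by rewrite eq_st ?subrr.
  - by move=> x; rewrite mem_undup (perm_mem perm1).
  - by move=> x; rewrite mem_undup.
apply/allP => -[a b] _ /=; rewrite -!count_fiber.
by apply/eqP/seq.permP/perm_eq_power_sums.
Qed.

End PowerSums.

Section Orbits.

Variables (K : fieldType) (n : nat).
Implicit Types p q : 'rV[K]_n * 'rV[K]_n.

Definition points p : n.-tuple (K * K) := [tuple (p.1 0 i, p.2 0 i) | i < n].

Lemma eval2_fjk j k p :
  eval2 (fjk K n j k) p = \sum_(z <- points p) z.1 ^+ j * z.2 ^+ k.
Proof.
rewrite /eval2 /fjk raddf_sum /= big_map big_enum /=; apply: eq_bigr => i _.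
by rewrite rmorphM !rmorphXn /= !mevalXU row_mxEl row_mxEr.
Qed.

Lemma msym_diag_X (s : 'S_n) i :
  msym (diag_perm s) 'X_i = 'X_(diag_fun s i) :> {mpoly K[n + n]}.
Proof.
rewrite msymX; congr 'X_[_]; apply/mnmP => j; rewrite !mnmE.
by rewrite -(inj_eq (@perm_inj _ (diag_perm s))) permKV permE.
Qed.

Lemma bisymmetric_fjk j k : bisymmetric (fjk K n j k).
Proof.
move=> s; rewrite /fjk raddf_sum /= [RHS](reindex_inj (@perm_inj _ s)) /=.
apply: eq_bigr => i _; rewrite rmorphM !rmorphXn /= !msym_diag_X /diag_fun.
rewrite -[lshift n i]/(unsplit (inl i)) -[rshift n i]/(unsplit (inr i)).
by rewrite !unsplitK.
Qed.

Lemma bisymmetric_eval2_perm f p q :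
  bisymmetric f -> perm_eq (points p) (points q) -> eval2 f p = eval2 f q.
Proof.
move=> f_sym /tuple_permP[s /val_inj eq_pq].
rewrite -[in RHS](f_sym s) eval2_msym; congr (eval2 f _).
have E i : (p.1 0 i, p.2 0 i) = (q.1 0 (s i), q.2 0 (s i)).
  by have := congr1 (fun w => tnth w i) eq_pq; rewrite !tnth_mktuple.
case: p q eq_pq E => [p1 p2] [q1 q2] _ /= E.
by congr (_, _); apply/rowP => i; rewrite mxE; case: (E i).
Qed.

End Orbits.

Theorem theorem1 (K : fieldType) (charK0 : [pchar K] =i pred0)
    (n : nat) (n_ge1 : (1 <= n)%N) :
  separating (@S_set K n).
Proof.
split=> [_ [j [k [_ ->]]]|p q [f [f_sym neq_f]]]; first exact: bisymmetric_fjk.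
(* Only finitely many (j, k) occur, so the search for a separating f_{j,k} is
   decidable. *)
pose sep (j k : 'I_n.+1) := (k <= n %/ j.+1)%N &&
  (eval2 (fjk K n j k) p != eval2 (fjk K n j k) q).
have [/existsP[j /existsP[k /andP[le_k /eqP neq_jk]]]|no_sep] :=
    boolP [exists j, exists k, sep j k].
  exists (fjk K n j k); split=> //; exists j, k; split=> //; split=> //.
    exact: (ltn_ord j).
  (* f_{0,0} is the constant n, so it never separates. *)
  move=> [j0 k0]; apply: neq_jk; rewrite !eval2_fjk j0 k0.
  by rewrite !big_map; apply: eq_bigr => i _; rewrite !expr0.
case: neq_f; apply: bisymmetric_eval2_perm => //.
apply: (perm_eq_bivariate_power_sums charK0 (n := n)); rewrite ?size_tuple //.
move=> j k le_jn le_k; rewrite -!eval2_fjk.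
have lt_kn : (k < n.+1)%N by rewrite ltnS (leq_trans le_k) ?leq_div.
apply/eqP/negPn/negP => neq_jk; case/negP: no_sep.
apply/existsP; exists (Ordinal (le_jn : (j < n.+1)%N)); apply/existsP.
by exists (Ordinal lt_kn); rewrite /sep le_k.
Qed.
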